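(* Let $(X,\circ,\backslash_{\circ},\bullet,/_{\bullet})$ be a left distributive birack and let $\sim$ be the congruence on $X$ given by $a\sim b\Leftrightarrow a\circ x=b\circ x$ for all $x\in X$. Then the quotient birack $(X/\mathord{\sim},\circ,\backslash_{\circ},\bullet,/_{\bullet})$ is idempotent and is equal to the left derived birack $\mathbf{B}_L(X/\mathord{\sim},\circ,\backslash_{\circ})$.
   Context: A birack is a set $X$ with four binary operations $\circ,\backslash_{\circ},\bullet,/_{\bullet}$ such that for all $x,y,z\in X$: $x\circ(x\backslash_{\circ} y)=y=x\backslash_{\circ}(x\circ y)$; $(y/_{\bullet}x)\bullet x=y=(y\bullet x)/_{\bullet}x$; $x\circ(y\circ z)=(x\circ y)\circ((x\bullet y)\circ z)$; $(x\circ y)\bullet((x\bullet y)\circ z)=(x\bullet(y\circ z))\circ(y\bullet z)$; $(x\bullet y)\bullet z=(x\bullet(y\circ z))\bullet(y\bullet z)$. The birack is left distributive if $x\circ(y\circ z)=(x\circ y)\circ(x\circ z)$ for all $x,y,z\in X$. In that case $\sim$ is a congruence (equivalence relation compatible with all four operations), so the quotient birack with induced operations is well defined. A birack is idempotent if $x\circ x=x=x\bullet x$ for all $x$. A left rack $(Y,\circ,\backslash_{\circ})$ is a left quasigroup ($x\circ(x\backslash_{\circ} y)=y=x\backslash_{\circ}(x\circ y)$) satisfying $x\circ(y\circ z)=(x\circ y)\circ(x\circ z)$. Its left derived birack $\mathbf{B}_L(Y,\circ,\backslash_{\circ})$ is $(Y,\circ,\backslash_{\circ},\bullet,/_{\bullet})$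 with $x\bullet y=x=x/_{\bullet}y$ for all $x,y\in Y$. *)

(* Defs.v *)
From mathcomp Require Import all_boot generic_quotient.
From mathcomp Require Import boolp.

Set Implicit Arguments.
Unset Strict Implicit.
Unset Printing Implicit Defensive.

Local Open Scope quotient_scope.

(* [lop x y] is x \circ y,             [ldiv x y] is x \backslash_\circ y,
   [rop x y] is x \bullet y,           [rdiv y x] is y /_\bullet x. *)
Record birack (X : Type) := Birack {
  lop : X -> X -> X;
  ldiv : X -> X -> X;
  rop : X -> X -> X;
  rdiv : X -> X -> X;
  lop_ldiv : forall x y, lop x (ldiv x y) = y;
  ldiv_lop : forall x y, ldiv x (lop x y) = y;
  rop_rdiv : forall x y, rop (rdiv y x) x = y;
  rdiv_rop : forall x y, rdiv (rop y x) x = y;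
  birack_lop : forall x y z,
    lop x (lop y z) = lop (lop x y) (lop (rop x y) z);
  birack_mix : forall x y z,
    rop (lop x y) (lop (rop x y) z) = lop (rop x (lop y z)) (rop y z);
  birack_rop : forall x y z,
    rop (rop x y) z = rop (rop x (lop y z)) (rop y z)
}.

Definition left_distributive_birack (X : Type) (B : birack X) : Prop :=
  forall x y z, lop B x (lop B y z) = lop B (lop B x y) (lop B x z).

Definition idempotent_birack (X : Type) (B : birack X) : Prop :=
  forall x, lop B x x = x /\ rop B x x = x.

Record left_rack (Y : Type) := LeftRack {
  rack_op : Y -> Y -> Y;
  rack_div : Y -> Y -> Y;
  rack_op_div : forall x y, rack_op x (rack_div x y) = y;
  rack_div_op : forall x y, rack_div x (rack_op x y) = y;
  rack_distr : forall x y z,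
    rack_op x (rack_op y z) = rack_op (rack_op x y) (rack_op x z)
}.

Definition left_derived_birack (Y : Type) (K : left_rack Y) : birack Y :=
  @Birack Y (rack_op K) (rack_div K) (fun x _ => x) (fun x _ => x)
    (@rack_op_div Y K) (@rack_div_op Y K)
    (fun _ _ => erefl) (fun _ _ => erefl)
    (@rack_distr Y K) (fun _ _ _ => erefl) (fun _ _ _ => erefl).

Definition left_rack_of_birack (Y : Type) (B : birack Y)
    (LD : left_distributive_birack B) : left_rack Y :=
  @LeftRack Y (lop B) (ldiv B) (@lop_ldiv Y B) (@ldiv_lop Y B) LD.

Definition compatible (X : Type) (R : X -> X -> Prop) (op : X -> X -> X) :=
  forall a a' b b', R a a' -> R b b' -> R (op a b) (op a' b').

Record congruence (X : Type) (B : birack X) (R : X -> X -> Prop) : Prop :=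
  Congruence {
    cong_refl : forall a, R a a;
    cong_sym : forall a b, R a b -> R b a;
    cong_trans : forall a b c, R a b -> R b c -> R a c;
    cong_lop : compatible R (lop B);
    cong_ldiv : compatible R (ldiv B);
    cong_rop : compatible R (rop B);
    cong_rdiv : compatible R (rdiv B)
  }.

Section Quotient.
Context (X : Type) (B : birack X) (R : X -> X -> Prop)
        (HR : congruence B R).

Let e : rel {classic X} := fun a b => `[< R a b >].

Lemma cong_equiv_class : equiv_class_of e.
Proof.
split.
- by move=> a; apply/asboolP/(cong_refl HR).
- by move=> a b; apply: asbool_equiv_eq; split; apply: (cong_sym HR).
- move=> b a c /asboolP ab /asboolP bc.
  by apply/asboolP/(cong_trans HR ab bc).
Qed.

Definition cong_equiv : equiv_rel {classic X} := EquivRelPack cong_equiv_class.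

Definition quotient : Type := {eq_quot cong_equiv}.

Definition proj (a : X) : quotient := \pi_{eq_quot cong_equiv} a.

Definition rep (q : quotient) : X := @repr _ {eq_quot cong_equiv} q.

Lemma repK q : proj (rep q) = q.
Proof. exact: reprK. Qed.

Lemma projP a b : proj a = proj b <-> R a b.
Proof.
split; last by move=> h; apply/eqquotP/asboolP.
by move=> /eqquotP /asboolP.
Qed.

Lemma projW (P : quotient -> Prop) : (forall a, P (proj a)) -> forall q, P q.
Proof. by move=> h q; rewrite -(repK q). Qed.

(* The representatives chosen here are immaterial when [op] is compatible
   with [R]: see [quotient_opE]. *)
Definition quotient_op (op : X -> X -> X) (p q : quotient) : quotient :=
  proj (op (rep p) (rep q)).

Lemma quotient_opE op : compatible R op ->
  forall a b, quotient_op op (proj a) (proj b) = proj (op a b).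
Proof. by move=> h a b; apply/projP; apply: h; apply/projP; rewrite repK. Qed.

Let lopE := quotient_opE (cong_lop HR).
Let ldivE := quotient_opE (cong_ldiv HR).
Let ropE := quotient_opE (cong_rop HR).
Let rdivE := quotient_opE (cong_rdiv HR).

Definition quotient_birack : birack quotient.
Proof.
apply: (@Birack quotient (quotient_op (lop B)) (quotient_op (ldiv B))
                         (quotient_op (rop B)) (quotient_op (rdiv B))).
- by elim/projW=> x; elim/projW=> y; rewrite ldivE lopE lop_ldiv.
- by elim/projW=> x; elim/projW=> y; rewrite lopE ldivE ldiv_lop.
- by elim/projW=> x; elim/projW=> y; rewrite rdivE ropE rop_rdiv.
- by elim/projW=> x; elim/projW=> y; rewrite ropE rdivE rdiv_rop.
- elim/projW=> x; elim/projW=> y; elim/projW=> z.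
  by rewrite !(lopE, ropE) birack_lop.
- elim/projW=> x; elim/projW=> y; elim/projW=> z.
  by rewrite !(lopE, ropE) birack_mix.
- elim/projW=> x; elim/projW=> y; elim/projW=> z.
  by rewrite !(lopE, ropE) birack_rop.
Defined.

Lemma quotient_left_distributive :
  left_distributive_birack B -> left_distributive_birack quotient_birack.
Proof.
move=> LD; elim/projW=> x; elim/projW=> y; elim/projW=> z /=.
by rewrite !lopE LD.
Qed.

End Quotient.

Arguments quotient_left_distributive {X B R} HR LD.

Definition left_equiv (X : Type) (B : birack X) (a b : X) : Prop :=
  forall x, lop B a x = lop B b x.

Lemma left_equiv_congruence (X : Type) (B : birack X) :
  left_distributive_birack B -> congruence B (left_equiv B).
Proof.
move=> LD.
have lop_inj x : injective (lop B x) := can_inj (ldiv_lop B x).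
have ropl x y : left_equiv B (rop B x y) x.
  by move=> z; apply: (lop_inj (lop B x y)); rewrite -birack_lop LD.
have rdivl x y : left_equiv B (rdiv B x y) x.
  by move=> z; rewrite -[in RHS](rop_rdiv B y x) ropl.
have ldiv_lopl a b x :
    lop B (ldiv B a b) x = ldiv B a (lop B b (lop B a x)).
  by apply: (lop_inj a); rewrite LD !lop_ldiv.
split.
- by [].
- by move=> a b h x; rewrite h.
- by move=> a b c h k x; rewrite h k.
- move=> a a' b b' ha hb x.
  by rewrite -ha -(lop_ldiv B a x) -!LD hb.
- move=> a a' b b' ha hb x.
  have ldivl y : ldiv B a y = ldiv B a' y.
    by apply: (lop_inj a); rewrite lop_ldiv ha lop_ldiv.
  by rewrite !ldiv_lopl -ldivl hb ha.
- by move=> a a' b b' ha hb x; rewrite !ropl.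
- by move=> a a' b b' ha hb x; rewrite !rdivl.
Qed.

(* Main.v *)
Require Import Defs.
From mathcomp Require Import all_boot.
From mathcomp Require Import boolp.

(** Comparing left distributivity with the first birack axiom gives
    [(x \bullet y) \circ z = x \circ z], i.e. [x \bullet y ~ x], so [\bullet] and
    [/_\bullet] become left projections on the quotient. Left distributivity with
    [y = x] gives [x \circ x ~ x], since every element is of the form
    [x \circ z]. *)

(** Once the operations are identified, the remaining fields are proofs of the same propositions,
    equal by proof irrelevance. *)
Lemma birack_ext (X : Type) (B C : birack X) :
  lop B = lop C -> ldiv B = ldiv C ->
  rop B = rop C -> rdiv B = rdiv C -> B = C.
Proof.
case: B => ? ? ? ? ? ? ? ? ? ? ?; case: C => ? ? ? ? ? ? ? ? ? ? ? /=.
by do 4![move=> ?; subst]; f_equal; exact: Prop_irrelevance.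
Qed.

Section LeftDistributive.
Context (X : Type) (B : birack X) (LD : left_distributive_birack B).

Lemma left_equiv_lop_diag x : left_equiv B (lop B x x) x.
Proof. by move=> z; rewrite -(lop_ldiv B x z) -LD. Qed.

Lemma left_equiv_rop x y : left_equiv B (rop B x y) x.
Proof.
move=> z; apply: (can_inj (ldiv_lop B (lop B x y))).
by rewrite -birack_lop LD.
Qed.

Lemma left_equiv_rdiv x y : left_equiv B (rdiv B x y) x.
(* Write [x] on the right as [rop B (rdiv B x y) y], which is equivalent to [rdiv B x y]. *)
Proof. by move=> z; rewrite -[in RHS](rop_rdiv B y x) left_equiv_rop. Qed.

End LeftDistributive.

Theorem lemma3p5 (X : Type) (B : birack X) (LD : left_distributive_birack B) :
  idempotent_birack (quotient_birack (left_equiv_congruence LD)) /\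
  quotient_birack (left_equiv_congruence LD) =
    left_derived_birack
      (left_rack_of_birack
        (quotient_left_distributive (left_equiv_congruence LD) LD)).
Proof.
set HR := left_equiv_congruence LD.
(* [quotient_op] is computed on representatives, so projecting up to equivalence is enough. *)
have quotient_opl (op : X -> X -> X) : (forall a b, left_equiv B (op a b) a) ->
    forall p q : quotient HR, quotient_op op p q = p.
  by move=> opl p q; rewrite -[RHS]repK; apply/projP/opl.
have ropl := quotient_opl _ (left_equiv_rop X B LD).
have rdivl := quotient_opl _ (left_equiv_rdiv X B LD).
split.
- move=> p; split; last exact: ropl.
  by rewrite -[RHS]repK; apply/projP/left_equiv_lop_diag.
(* [lop] and [ldiv] agree by conversion; only [rop] and [rdiv] remain. *)
- by apply: birack_ext => //; apply/funext => p; apply/funext => q;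
    [exact: ropl | exact: rdivl].
Qed.
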